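(* Let $S$ be a semiring and let $\mathfrak{a}$ be a proper $z$-ideal of $S$. Then $\mathfrak{a}=\bigcap\{\mathfrak{b}\mid \mathfrak{b}\text{ is a } z\text{-irreducible ideal of } S \text{ and } \mathfrak{a}\subseteq\mathfrak{b}\}$.
   Context: A (commutative) semiring is a system $(S,+,0,\cdot,1)$ with $(S,+,0)$ and $(S,\cdot,1)$ commutative monoids, $0s=0$ for all $s\in S$, and multiplication distributing over addition. An ideal of $S$ is a nonempty subset closed under addition and under multiplication by elements of $S$; it is proper if it is not $S$. $\mathrm{Max}(S)$ is the set of maximal (proper) ideals of $S$, and for $x\in S$, $\mathcal{M}_x=\{\mathfrak{m}\in\mathrm{Max}(S)\mid x\in\mathfrak{m}\}$. An ideal $\mathfrak{z}$ of $S$ is a $z$-ideal if $\bigcap\mathcal{M}_x\subseteq\mathfrak{z}$ for every $x\in\mathfrak{z}$ (the intersection of the empty family is $S$). A $z$-ideal $\mathfrak{a}$ is $z$-irreducible if for all $z$-ideals $\mathfrak{b},\mathfrak{b}'$ of $S$, $\mathfrak{b}\cap\mathfrak{b}'=\mathfrak{a}$ implies $\mathfrak{b}=\mathfrak{a}$ or $\mathfrak{b}'=\mathfrak{a}$. *)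

(* Defs.v *)
From HB Require Import structures.
From mathcomp Require Import all_boot all_order all_algebra.
From mathcomp Require Import classical_sets.

Set Implicit Arguments.
Unset Strict Implicit.
Unset Printing Implicit Defensive.

Import GRing.Theory.

Local Open Scope classical_set_scope.
Local Open Scope ring_scope.

(* The ideals of mathcomp.algebra.ring_quotient are boolean predicates, proper,
   and restricted to nontrivial rings; commutative semirings (possibly with
   0 = 1) need the notions below. *)

Definition is_ideal (S : comPzSemiRingType) (I : set S) : Prop :=
  [/\ I !=set0,
      forall x y, I x -> I y -> I (x + y)
    & forall s x, I x -> I (s * x)].

Definition is_proper_ideal (S : comPzSemiRingType) (I : set S) : Prop :=
  is_ideal I /\ I <> [set: S].

Definition Max (S : comPzSemiRingType) : set (set S) :=
  [set m | is_proper_ideal m /\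
           forall n : set S, is_proper_ideal n -> m `<=` n -> n = m].

Definition Max_at (S : comPzSemiRingType) (x : S) : set (set S) :=
  [set m | Max m /\ m x].

(* When [Max_at x] is empty, the intersection is [set: S]. *)
Definition is_z_ideal (S : comPzSemiRingType) (z : set S) : Prop :=
  is_ideal z /\ forall x, z x -> \bigcap_(m in Max_at x) m `<=` z.

(* Properness is not required: [set: S] itself is z-irreducible. *)
Definition is_z_irreducible (S : comPzSemiRingType) (a : set S) : Prop :=
  is_z_ideal a /\
  forall b b' : set S, is_z_ideal b -> is_z_ideal b' ->
    b `&` b' = a -> b = a \/ b' = a.

(* Main.v *)
Require Import Defs.
From mathcomp Require Import all_boot all_order all_algebra.
From mathcomp Require Import classical_sets.
From mathcomp Require Import boolp.

Local Open Scope classical_set_scope.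

(** For [y] outside [a], Zorn's lemma yields a z-ideal maximal among those
    containing [a] and missing [y]. It is z-irreducible: any two strictly larger
    z-ideals both contain [y], so their intersection contains [y] as well. *)

(* Chains are taken among the sets [X] with [a `|` X] a z-ideal missing [y], so
   that the union of the empty chain causes no trouble. *)
Lemma exists_maximal_z_ideal_avoiding (S : comPzSemiRingType) (a : set S)
    (y : S) : is_z_ideal a -> ~ a y ->
  exists c : set S, [/\ is_z_ideal c, a `<=` c, ~ c y &
    forall b : set S, is_z_ideal b -> c `<=` b -> ~ b y -> b = c].
Proof.
move=> za nay.
pose P := [set X : set S | is_z_ideal (a `|` X) /\ ~ (a `|` X) y].
have [F FP Ftot|A [[zA nAy] Amax]] := @Zorn_bigcup S P; last first.
  exists (a `|` A); split=> // b zb cb nby.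
  have ab : a `|` b = b by apply/setUidPr => x ax; apply: cb; left.
  apply/seteqP; split=> // x bx; right; apply: contrapT => nAx.
  (* As [b] contains [a], their union is [b], so [P b] holds; [x] makes [b] strictly larger than
     [A]. *)
  apply: (Amax b); last by split; rewrite ab.
  split; first by move=> z Az; apply: cb; right.
  by move=> bA; exact: nAx (bA x bx).
pose U := \bigcup_(X in F) X.
(* [set0] replaces a member of the chain for points of [a]; [F] may be empty. *)
have P0 : P set0 by split; rewrite setU0.
have mem1 x : (a `|` U) x -> exists2 Z, P Z & Z `<=` U /\ (a `|` Z) x.
  case=> [ax|[Z FZ Zx]]; first by exists set0 => //; split=> //; left.
  by exists Z; [exact: FP|split; [exact: bigcup_sup|right]].
(* Closure under addition needs both points in one ideal: take the larger of two sets of the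
   chain. *)
have mem2 x x' : (a `|` U) x -> (a `|` U) x' ->
    exists2 Z, P Z & [/\ Z `<=` U, (a `|` Z) x & (a `|` Z) x'].
  case=> [ax Ux'|[Z FZ Zx]].
    by have [Z PZ [ZU Zx']] := mem1 _ Ux'; exists Z => //; split=> //; left.
  case=> [ax'|[Z' FZ' Zx']].
    by exists Z; [exact: FP|split; [exact: bigcup_sup|right|left]].
  have [ZZ'|Z'Z] := Ftot Z Z' FZ FZ'.
    exists Z'; first exact: FP.
    by split; [exact: bigcup_sup|right; exact: ZZ'|right].
  exists Z; first exact: FP.
  by split; [exact: bigcup_sup|right|right; exact: Z'Z].
split; last by move=> /mem1[Z [_ nZy] [_ /nZy]].
split; first split.
- by case: za => -[[x ax] _ _] _; exists x; left.
- move=> x x' /mem2 /[apply] -[Z [[[_ ZD _] _] _] [ZU Zx Zx']].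
  exact: setUS ZU _ (ZD _ _ Zx Zx').
(* Absorption and the z-condition each start from a single point, so a single [Z] settles them. *)
- move=> s x /mem1[Z [[[_ _ ZM] _] _] [ZU Zx]].
  exact: setUS ZU _ (ZM s _ Zx).
- move=> x /mem1[Z [[_ Zz] _] [ZU Zx]].
  exact: subset_trans (Zz _ Zx) (setUS ZU).
Qed.

Lemma maximal_avoiding_z_irreducible (S : comPzSemiRingType) (c : set S)
    (y : S) : is_z_ideal c -> ~ c y ->
  (forall b : set S, is_z_ideal b -> c `<=` b -> ~ b y -> b = c) ->
  is_z_irreducible c.
Proof.
move=> zc ncy cmax; split=> // b b' zb zb' bb'c.
(* One of [b] and [b'] misses [y], as their intersection [c] does; by maximality it equals [c]. *)
have [by_|nby] := pselect (b y); last first.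
  by left; apply: cmax => //; rewrite -bb'c; exact: subIsetl.
right; apply: cmax => //; first by rewrite -bb'c; exact: subIsetr.
by move=> b'y; apply: ncy; rewrite -bb'c.
Qed.

Theorem proposition4p22 (S : comPzSemiRingType) (a : set S)
    (ha : is_z_ideal a) (hproper : a <> [set: S]) :
  a = \bigcap_(b in [set b : set S | is_z_irreducible b /\ a `<=` b]) b.
Proof.
apply/seteqP; split=> [x ax b [_ ab]|y ycap]; first exact: ab.
apply: contrapT => nay.
have [c [zc ac ncy cmax]] := exists_maximal_z_ideal_avoiding S a y ha nay.
(* [c] is among the intersected ideals, so [y] would lie in [c]. *)
apply: (ncy); apply: (ycap c); split=> //.
exact: (maximal_avoiding_z_irreducible S c y zc ncy cmax).
Qed.
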